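(* Consider the federated setting with $K$ clients described in the context, with client objectives $J_k:\mathbb{R}^d\to\mathbb{R}$, global objective $J=\frac1K\sum_{k=1}^KJ_k$, and human-feedback weight $\lambda>0$. Assume that there are constants $L,G,\sigma,M,\mu,H_{\max}$ with $\mu>0$ such that: (1) for all $\theta,\theta'\in\mathbb{R}^d$ and all $k\in\{1,\dots,K\}$, $\|\nabla J_k(\theta)-\nabla J_k(\theta')\|\le L\|\theta-\theta'\|$; (2) for all $\theta$ and $k$, $\|\nabla J_k(\theta)\|\le G$; (3) for all $\theta$ and $k$, the variance of the stochastic gradient estimator is bounded: $\mathbb{E}[\|\nabla\hat J_k(\theta)-\nabla J_k(\theta)\|^2]\le\sigma^2$; (4) for all $\theta$ and $k$, $\mathbb{E}[\|\nabla\hat J_k(\theta)\|^2]\le M^2$; (5) (Polyak-Łojasiewicz condition) $2\mu\,(J(\theta^* )-J(\theta))\le\|\nabla J(\theta)\|^2$ for all $\theta\in\mathbb{R}^d$, where $\theta^*=\arg\max_\theta J(\theta)$; (6) $|H_k(s,a)|\le H_{\max}$ for all $s\in\mathcal S$, $a\in\mathcal A$ and all $k$. Then for any set of client policies $\{\pi_k(\cdot|s,\theta)\}_{k=1}^K$ and the global policy $\pi(\cdot|s,\theta)$, the global performance metric $J_g$ satisfies $$J_g(\theta)\ge\frac1K\sum_{k=1}^KJ_k^0(\pi_k)-C\cdot\left(\frac1K\sum_{k=1}^K\sqrt{P_k(\theta)}\right),$$ where $P_k(\theta)$ is the personalization score of client $k$, and $C>0$ is the constant $$C=\frac{2\sqrt2\,R_{\mathrm{total},\max}}{(1-\gamma)^2},\qquad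 R_{\mathrm{total},\max}=R_{\max}+\lambda H_{\max},$$ $R_{\mathrm{total},\max}$ being the maximum possible total reward.
   Context: Setting. There are $K$ clients. Client $k$ has a Markov decision process $M_k=(\mathcal S,\mathcal A,P_k,R_k,\rho_0,\gamma)$ with common state space $\mathcal S$, action space $\mathcal A$, initial state distribution $\rho_0$ and discount factor $\gamma\in[0,1)$; the transition kernel (also denoted $P_k$, not to be confused with the personalization score $P_k(\theta)$ below) and the reward $R_k$ may differ across clients. The reward is shaped by human feedback: $R_k(s,a)=R_k^0(s,a)+\lambda H_k(s,a)$, where $R_k^0$ is the intrinsic reward, $H_k:\mathcal S\times\mathcal A\to\mathbb R$ is the client's human feedback function and $\lambda>0$. For a stochastic policy $\pi_\theta$ parameterized by $\theta\in\mathbb R^d$, the client objective is $J_k(\theta)=\mathbb{E}\big[\sum_{t\ge0}\gamma^tR_k(s_t,a_t)\big]$, the expectation being over trajectories generated by $\pi_\theta$ in $M_k$ with $s_0\sim\rho_0$. $\nabla\hat J_k(\theta)$ denotes the stochastic gradient (estimate of $\nabla J_k(\theta)$) computed from a mini-batch sampled with $\pi_\theta$ in $M_k$. Definitions. Maximum reward: $R_{\max}=\max_{k\in\{1,\dots,K\},\,s\in\mathcal S,\,a\in\mathcal A}|R_k^0(s,a)|$. Personalization score: for a client $k$ with policy $\pi_k(\cdot|s,\theta)$ and the global policy $\pi(\cdot|s,\theta)$, $P_k(\theta)=\mathbb{E}_{s\sim\rho}\big[D_{\mathrm{KL}}(\pi_k(\cdot|s,\theta)\,\|\,\pi(\cdot|s,\theta))\big]$,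 where $\rho$ is the (fixed) state distribution and $D_{\mathrm{KL}}$ is the Kullback-Leibler divergence. Intrinsic performance of a policy $\pi'$ for client $k$: $J_k^0(\pi')=\mathbb{E}_{\tau\sim\pi'}\big[\sum_{t\ge0}\gamma^tR_k^0(s_t,a_t)\big]$, over trajectories $\tau$ generated by $\pi'$ in $M_k$ starting from $s_0\sim\rho_0$. Global performance metric: $J_g(\theta)=\frac1K\sum_{k=1}^KJ_k^0(\pi)$, where $\pi=\pi(\cdot|s,\theta)$ is the global policy.
   Formalization: The state distribution ρ, left unspecified, is taken for each client k to be the normalised discounted state distribution in M_k of π_k or of π (for arbitrary ρ the bound is false); positivity of C is not asserted, since C = 0 when all rewards vanish. *)

(* Defs.v *)
(* The state and action spaces are arbitrary measurable spaces; finite spaces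
   with the discrete sigma-algebra are a special case. *)
From HB Require Import structures.
From mathcomp Require Import all_boot all_order all_algebra.
From mathcomp Require Import all_classical all_reals all_analysis.

Set Implicit Arguments.
Unset Strict Implicit.
Unset Printing Implicit Defensive.

Import Order.TTheory GRing.Theory Num.Theory.
Import numFieldNormedType.Exports.

Local Open Scope classical_set_scope.
Local Open Scope ring_scope.

(* The library norm on row vectors is the sup norm, hence this definition. *)
Definition enorm (R : realType) (d : nat) (v : 'rV[R]_d) : R :=
  Num.sqrt (\sum_(i < d) v ord0 i ^+ 2).

Definition gradient (R : realType) (d : nat) (f : 'rV[R]_d -> R)
    (x : 'rV[R]_d) : 'rV[R]_d :=
  \row_(i < d) 'D_(delta_mx ord0 i) f x.

(* +oo when P is not absolutely continuous with respect to Q; otherwise the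
   integral always makes sense in [0, +oo], the negative part of
   ln (dP/dQ) being P-integrable. *)
Definition KL (R : realType) d (T : measurableType d) (P Q : probability T R)
    : \bar R :=
  if `[< P `<< Q >]
  then (\int[P]_x lne (Radon_Nikodym (charge_of_finite_measure P) Q x))%E
  else +oo%E.

Definition policy (R : realType) dS dA (S : measurableType dS)
  (A : measurableType dA) := R.-pker S ~> A.

(* pi(.|s), repackaged: the library does not infer that the values of a
   probability kernel are probability measures. *)
Definition policy_at (R : realType) dS dA (S : measurableType dS)
    (A : measurableType dA) (pi : policy R S A) (s : S) : set A -> \bar R :=
  pi s.

Section policy_at_probability.
Context (R : realType) dS dA (S : measurableType dS) (A : measurableType dA).
Variables (pi : policy R S A) (s : S).

HB.instance Definition _ := Measure.on (policy_at pi s).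

Let policy_at_setT : policy_at pi s [set: A] = 1%E.
Proof. exact: prob_kernel. Qed.

HB.instance Definition _ :=
  Measure_isProbability.Build _ _ _ (policy_at pi s) policy_at_setT.

End policy_at_probability.

(* The K client MDPs: common spaces, initial distribution and discount,
   client-dependent transition kernels and rewards. *)
Record federation (R : realType) dS dA (S : measurableType dS)
    (A : measurableType dA) (K : nat) := Federation {
  init : probability S R ;
  discount : R ;
  trans : 'I_K -> R.-pker (S * A)%type ~> S ;
  intrinsic_reward : 'I_K -> S * A -> R ;
  feedback : 'I_K -> S * A -> R ;
  feedback_weight : R ;
  discount_ge0 : 0 <= discount ;
  discount_lt1 : discount < 1 ;
  measurable_intrinsic_reward :
    forall k, measurable_fun [set: S * A] (intrinsic_reward k) ;
  measurable_feedback :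
    forall k, measurable_fun [set: S * A] (feedback k) ;
  feedback_weight_gt0 : 0 < feedback_weight }.

Definition total_reward (R : realType) dS dA (S : measurableType dS)
    (A : measurableType dA) (K : nat) (F : federation R S A K) (k : 'I_K)
    (x : S * A) : R :=
  intrinsic_reward F k x + feedback_weight F * feedback F k x.

(* Cylinder event: s_i lies in B i for i <= t, a_i lies in C i for i < t. *)
Definition history (Omega S A : Type) (st : nat -> Omega -> S)
    (ac : nat -> Omega -> A) (B : nat -> set S) (C : nat -> set A) (t : nat)
    : set Omega :=
  [set w | (forall i, (i <= t)%N -> B i (st i w)) /\
           (forall i, (i < t)%N -> C i (ac i w))].

(* The random trajectory (s_0, a_0, s_1, a_1, ...) generated by pi in M_k, on
   some probability space: s_0 ~ init, and given the past, a_t ~ pi(.|s_t) and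
   s_(t+1) ~ P_k(.|s_t, a_t).  The conditional laws are expressed on the
   cylinder events, which generate the sigma-algebra of the past. *)
Record trajectory (R : realType) dS dA (S : measurableType dS)
    (A : measurableType dA) (K : nat) (F : federation R S A K) (k : 'I_K)
    (pi : policy R S A) := Trajectory {
  disp : measure_display ;
  sample : measurableType disp ;
  law : probability sample R ;
  state : nat -> sample -> S ;
  action : nat -> sample -> A ;
  measurable_state : forall t, measurable_fun [set: sample] (state t) ;
  measurable_action : forall t, measurable_fun [set: sample] (action t) ;
  state0_law : forall B, measurable B -> law (state 0%N @^-1` B) = init F B ;
  action_law : forall (t : nat) (B : nat -> set S) (C : nat -> set A),
    (forall i, measurable (B i)) -> (forall i, measurable (C i)) ->
    law (history state action B C t `&` action t @^-1` C t) =
    (\int[law]_(w in history state action B C t) pi (state t w) (C t))%E ;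
  state_law : forall (t : nat) (B : nat -> set S) (C : nat -> set A),
    (forall i, measurable (B i)) -> (forall i, measurable (C i)) ->
    law (history state action B C t.+1) =
    (\int[law]_(w in history state action B C t `&` action t @^-1` C t)
       trans F k (state t w, action t w) (B t.+1))%E }.

Arguments state {R dS dA S A K F k pi} _ _ _.
Arguments action {R dS dA S A K F k pi} _ _ _.

(* A realisation of every trajectory process of the federation. *)
Definition trajectories (R : realType) dS dA (S : measurableType dS)
    (A : measurableType dA) (K : nat) (F : federation R S A K) :=
  forall (k : 'I_K) (pi : policy R S A), trajectory F k pi.

Section performance.
Context (R : realType) dS dA (S : measurableType dS) (A : measurableType dA).
Context (K d : nat) (F : federation R S A K) (tau : trajectories F).

Definition expected_return (r : S * A -> R) (k : 'I_K) (pi : policy R S A) : R :=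
  fine ('E_(law (tau k pi))[fun w =>
    limn (series (fun t => discount F ^+ t *
      r (state (tau k pi) t w, action (tau k pi) t w)))%R])%E.

Definition client_objective (pi : 'rV[R]_d -> policy R S A) (k : 'I_K)
    (theta : 'rV[R]_d) : R :=
  expected_return (total_reward F k) k (pi theta).

Definition global_objective (pi : 'rV[R]_d -> policy R S A)
    (theta : 'rV[R]_d) : R :=
  K%:R^-1 * \sum_(k < K) client_objective pi k theta.

Definition intrinsic_performance (k : 'I_K) (pi : policy R S A) : R :=
  expected_return (intrinsic_reward F k) k pi.

Definition global_performance (pi : 'rV[R]_d -> policy R S A)
    (theta : 'rV[R]_d) : R :=
  K%:R^-1 * \sum_(k < K) intrinsic_performance k (pi theta).

(* rho is the normalised discounted state distribution of pi in M_k: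
   rho(B) = (1 - gamma) sum_t gamma^t Pr(s_t in B). *)
Definition state_distribution (k : 'I_K) (pi : policy R S A)
    (rho : probability S R) : Prop :=
  forall B, measurable B -> rho B =
    ((1 - discount F)%:E * \sum_(0 <= t <oo)
      (discount F ^+ t)%:E * law (tau k pi) (state (tau k pi) t @^-1` B))%E.

End performance.

Definition personalization_score (R : realType) dS dA (S : measurableType dS)
    (A : measurableType dA) (d : nat) (rho : probability S R)
    (pik pi : 'rV[R]_d -> policy R S A) (theta : 'rV[R]_d) : \bar R :=
  (\int[rho]_s KL (policy_at (pik theta) s) (policy_at (pi theta) s))%E.

Definition is_max_reward (R : realType) dS dA (S : measurableType dS)
    (A : measurableType dA) (K : nat) (F : federation R S A K) (Rmax : R) :=
  (forall k s a, `|intrinsic_reward F k (s, a)| <= Rmax) /\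
  (exists k s a, `|intrinsic_reward F k (s, a)| = Rmax).

(* Main.v *)
(* Proof idea.  Let V be a value iterate of one of the two policies, hence an
   approximate fixed point of its Bellman operator up to gamma^n Rmax.  Telescoping
   the return of the other policy against V writes the performance gap, up to
   O(gamma^n), as 1/(1-gamma) times the mean, under the discounted state law of
   that other policy, of the difference of the two policies integrated against
   an action value bounded by Rmax/(1-gamma).  The Donsker-Varadhan lower bound
   KL >= t D - 2 t^2, for D the difference of the two means of a function
   bounded by 1, is then integrated over the states with a constant t, which
   yields (mean of D)^2 <= 8 (mean KL) without any measurability of KL and
   without a separate Cauchy-Schwarz step.  Let n tend to infinity. *)
Require Import Defs.
From HB Require Import structures.
From mathcomp Require Import all_boot all_order all_algebra.
From mathcomp Require Import all_classical all_reals all_analysis.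
From mathcomp Require Import measurable_realfun giry.
From mathcomp Require Import ring lra.

Import Order.TTheory GRing.Theory Num.Theory.
Import numFieldNormedType.Exports.

Local Open Scope classical_set_scope.
Local Open Scope ring_scope.

Set Implicit Arguments.
Unset Strict Implicit.
Unset Printing Implicit Defensive.

(** * Integration of bounded measurable functions *)

Section bounded_measurable.
Context (R : realType) d (T : measurableType d).
Implicit Types (f g : T -> R) (B C : R).

(** The explicit bound is propagated through sums, kernels and Bellman operators; it gives
    integrability under every probability measure and bounds the mean. *)
Definition bmeas B f := measurable_fun [set: T] f /\ forall x, `|f x| <= B.

Lemma bmeas_cst c : bmeas `|c| (cst c).
Proof. by split=> //; exact: measurable_cst. Qed.

Lemma bmeas_shift_ge0 B f : bmeas B f -> forall x, 0 <= f x + B.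
Proof. by move=> [_ fB] x; have := fB x; rewrite ler_norml => /andP[? _]; lra. Qed.

Lemma bmeasD B C f g : bmeas B f -> bmeas C g ->
  bmeas (B + C) (fun x => f x + g x).
Proof.
move=> [mf fB] [mg gC]; split; first exact: measurable_funD.
by move=> x; rewrite (le_trans (ler_normD _ _))// lerD.
Qed.

Lemma bmeasB B C f g : bmeas B f -> bmeas C g ->
  bmeas (B + C) (fun x => f x - g x).
Proof.
move=> [mf fB] [mg gC]; split; first exact: measurable_funB.
by move=> x; rewrite (le_trans (ler_normB _ _))// lerD.
Qed.

Lemma bmeasZ c B f : bmeas B f -> bmeas (`|c| * B) (fun x => c * f x).
Proof.
move=> [mf fB]; split; first exact: measurable_funM.
by move=> x; rewrite normrM ler_wpM2l.
Qed.

Lemma bmeas_integrable (mu : probability T R) B f :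
  bmeas B f -> mu.-integrable [set: T] (EFin \o f).
Proof.
move=> [mf fB]; apply: measurable_bounded_integrable => //.
  exact: le_lt_trans (probability_le1 mu measurableT) (ltry 1).
exists B; split; first exact: num_real.
by move=> M BM x _; exact: le_trans (ltW BM).
Qed.

Lemma bmeas_EFin (mu : probability T R) B f : bmeas B f ->
  (\int[mu]_x f x)%:E = (\int[mu]_x (f x)%:E)%E.
Proof.
move=> bf; rewrite /Rintegral fineK// integrable_fin_num//.
exact: bmeas_integrable bf.
Qed.

Lemma probability_Rintegral_cst (mu : probability T R) (c : R) : \int[mu]_x c = c.
Proof. by rewrite Rintegral_cst// [X in fine X](probability_setT mu) mulr1. Qed.

Lemma bmeas_RintegralD (mu : probability T R) B C f g : bmeas B f -> bmeas C g ->
  \int[mu]_x (f x + g x) = \int[mu]_x f x + \int[mu]_x g x.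
Proof.
by move=> bf bg; rewrite RintegralD//;
  [exact: bmeas_integrable bf|exact: bmeas_integrable bg].
Qed.

Lemma bmeas_RintegralB (mu : probability T R) B C f g : bmeas B f -> bmeas C g ->
  \int[mu]_x (f x - g x) = \int[mu]_x f x - \int[mu]_x g x.
Proof.
by move=> bf bg; rewrite RintegralB//;
  [exact: bmeas_integrable bf|exact: bmeas_integrable bg].
Qed.

Lemma bmeas_RintegralZl (mu : probability T R) B c f : bmeas B f ->
  \int[mu]_x (c * f x) = c * \int[mu]_x f x.
Proof. by move=> bf; rewrite RintegralZl//; exact: bmeas_integrable bf. Qed.

Lemma bmeas_le_Rintegral (mu : probability T R) B C f g : bmeas B f -> bmeas C g ->
  (forall x, f x <= g x) -> \int[mu]_x f x <= \int[mu]_x g x.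
Proof.
by move=> bf bg fg; apply: le_Rintegral => //;
  [exact: bmeas_integrable bf|exact: bmeas_integrable bg].
Qed.

Lemma bmeas_norm_Rintegral (mu : probability T R) B f : bmeas B f ->
  `|\int[mu]_x f x| <= B.
Proof.
move=> bf; have [mf fB] := bf.
apply: (le_trans (le_normr_Rintegral _ _)) => //.
  exact: bmeas_integrable bf.
rewrite -[leRHS](probability_Rintegral_cst mu).
apply: (@bmeas_le_Rintegral mu B `|B| (fun x => `|f x|) (cst B)).
- by split=> [|x]; [exact: measurableT_comp|rewrite normr_id].
- exact: bmeas_cst.
- by move=> x; exact: fB.
Qed.

End bounded_measurable.

Section bounded_measurable_comp.
Context (R : realType) d d' (T : measurableType d) (T' : measurableType d').

Lemma bmeas_comp (phi : T -> T') B (f : T' -> R) :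
  measurable_fun [set: T] phi -> bmeas B f -> bmeas B (fun x => f (phi x)).
Proof. by move=> mphi [mf fB]; split=> // ; exact: measurableT_comp. Qed.

End bounded_measurable_comp.

Section bounded_measurable_kernel.
Context (R : realType) d d' (T : measurableType d) (T' : measurableType d').

(** Measurability is first obtained for the nonnegative function [g + B]; since [policy_at k x] has
    mass 1, the shift is exactly [B]. Here [policy] is any probability kernel, so transition kernels
    are covered. *)
Lemma bmeas_kernel (k : policy R T T') B (g : T * T' -> R) : bmeas B g ->
  bmeas B (fun x => \int[policy_at k x]_y g (x, y)).
Proof.
move=> [mg gB]; have bgx x : bmeas B (fun y => g (x, y)).
  by apply: bmeas_comp (conj mg gB); exact: pair1_measurable.
split; last by move=> x; exact: bmeas_norm_Rintegral.
have B0 := bmeas_shift_ge0 (conj mg gB).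
have shift x : \int[policy_at k x]_y g (x, y) =
    \int[policy_at k x]_y (g (x, y) + B) - B.
  rewrite (bmeas_RintegralD (policy_at k x) (bgx x) (bmeas_cst _ B)).
  by rewrite (probability_Rintegral_cst (policy_at k x)) addrK.
have -> : (fun x => \int[policy_at k x]_y g (x, y)) =
    (fun x => \int[policy_at k x]_y (g (x, y) + B) - B) by exact/funext.
apply: measurable_funB => //.
apply: (measurableT_comp (f := @fine R)) => //.
apply: (measurable_fun_integral_finite_kernel (fun z => (g z + B)%:E) k).
  by move=> z; rewrite lee_fin.
by apply/measurable_EFinP; exact: measurable_funD.
Qed.

End bounded_measurable_kernel.

(** * Laws generated by a kernel and iterated integrals *)

Section disintegration.
Context (R : realType) dO dX dA dT (Omega : measurableType dO)
  (X : measurableType dX) (A : measurableType dA) (T : measurableType dT).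
Variables (mu : probability Omega R) (x : Omega -> X) (k : policy R X A).
Variable phi : X * A -> T.
Hypothesis mx : measurable_fun [set: Omega] x.
Hypothesis mphi : measurable_fun [set: X * A] phi.

Let mphi1 u : measurable_fun [set: A] (fun a => phi (u, a)).
Proof. by apply: (measurableT_comp mphi); exact: pair1_measurable. Qed.

Definition kernel_image (w : Omega) : giry T R :=
  giry_map (mphi1 (x w)) (policy_at k (x w)).

Lemma measurable_kernel_image : measurable_fun [set: Omega] kernel_image.
Proof.
apply: measurable_giry_codensity => // B mB.
apply: (measurableT_comp (f := fun u => k u ((fun a => phi (u, a)) @^-1` B))) => //.
have mpB : phi @^-1` B \in measurable.
  by rewrite inE -[X in measurable X]setTI; exact: mphi.
have := measurable_fun_xsection_finite_kernel k mpB.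
by congr measurable_fun; apply/funext => u; rewrite xsectionE.
Qed.

(** In the Giry monad, the law of [phi (x w, a)] when [w] follows [mu] and [a] is drawn from
    [k (x w)]. Taking [phi] to be [snd] gives a marginal law, [id] a joint one. *)
Definition mixture : giry T R :=
  giry_bind (mu : subprobability Omega R) measurable_kernel_image.

Lemma mixtureE B : measurable B ->
  mixture B = (\int[mu]_w k (x w) ((fun a => phi (x w, a)) @^-1` B))%E.
Proof.
move=> mB; rewrite /mixture /giry_bind/= giry_int_map//.
exact: measurable_giry_ev.
Qed.

Lemma disintegration (y : Omega -> T) (my : measurable_fun [set: Omega] y) B
    (h : T -> R) :
  (forall U, measurable U -> mu (y @^-1` U) = mixture U) -> bmeas B h ->
  \int[mu]_w h (y w) = \int[mu]_w \int[policy_at k (x w)]_a h (phi (x w, a)).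
Proof.
move=> law bh; have [mh _] := bh.
have bp : bmeas B (fun z => h (phi z)) by exact: bmeas_comp bh.
have bk := bmeas_kernel k bp.
have hB0 := bmeas_shift_ge0 bh.
(* The rules for integrals against a bind or an image concern nonnegative functions, hence the shift
   by [B], which adds the same constant to both sides. *)
apply: (@addIr _ B).
rewrite -[in LHS](probability_Rintegral_cst mu B).
rewrite -[in RHS](probability_Rintegral_cst mu B).
rewrite -(bmeas_RintegralD mu (bmeas_comp my bh) (bmeas_cst _ B)).
rewrite -(bmeas_RintegralD mu (bmeas_comp mx bk) (bmeas_cst _ B)).
rewrite /Rintegral; congr fine.
have mhB : measurable_fun [set: T] (fun t => (h t + B)%:E).
  by apply/measurable_EFinP; exact: measurable_funD.
have hB0E t : (0 <= (h t + B)%:E)%E by rewrite lee_fin.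
transitivity (giry_int (giry_map my (mu : subprobability Omega R))
  (fun t => (h t + B)%:E)).
  by rewrite giry_int_map.
transitivity (giry_int mixture (fun t => (h t + B)%:E)).
  apply: eq_measure_integral => U mU _; exact: law.
rewrite giry_int_bind//; apply: eq_integral => w _.
rewrite giry_int_map// /giry_int/=.
have bpw : bmeas B (fun a => h (phi (x w, a))).
  by apply: bmeas_comp bp; exact: pair1_measurable.
rewrite -(bmeas_EFin (policy_at k (x w)) (bmeasD bpw (bmeas_cst _ B))).
rewrite (bmeas_RintegralD (policy_at k (x w)) bpw (bmeas_cst _ B)).
by rewrite (probability_Rintegral_cst (policy_at k (x w))).
Qed.

End disintegration.

Section markov_transitions.
Context (R : realType) dO dX dA (Omega : measurableType dO)
  (X : measurableType dX) (A : measurableType dA).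
Variables (mu : probability Omega R) (x : Omega -> X) (y : Omega -> A).
Variable k : policy R X A.
Hypothesis mx : measurable_fun [set: Omega] x.
Hypothesis my : measurable_fun [set: Omega] y.

Lemma marginal_disintegration B (h : A -> R) :
  (forall U, measurable U -> mu (y @^-1` U) = (\int[mu]_w k (x w) U)%E) ->
  bmeas B h ->
  \int[mu]_w h (y w) = \int[mu]_w \int[policy_at k (x w)]_a h a.
Proof.
move=> law bh.
have ms : measurable_fun [set: X * A] snd by exact: measurable_snd.
rewrite (disintegration (mu := mu) (k := k) (mx := mx) (mphi := ms)
  my _ bh)// => U mU.
by rewrite mixtureE// law.
Qed.

(** The joint law is prescribed on rectangles only; these form a generating pi-system of the
    product, so two finite measures that agree on them are equal. *)
Lemma joint_disintegration B (g : X * A -> R) :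
  (forall U V, measurable U -> measurable V ->
    mu (x @^-1` U `&` y @^-1` V) = (\int[mu]_(w in x @^-1` U) k (x w) V)%E) ->
  bmeas B g ->
  \int[mu]_w g (x w, y w) = \int[mu]_w \int[policy_at k (x w)]_a g (x w, a).
Proof.
move=> law bg.
have mxy : measurable_fun [set: Omega] (fun w => (x w, y w)).
  exact: measurable_fun_pair.
have mid : measurable_fun [set: X * A] id by exact: measurable_id.
rewrite (disintegration (mu := mu) (k := k) (mx := mx) (mphi := mid)
  mxy _ bg)// => W mW.
pose C := [set U `*` V | U in @measurable _ X & V in @measurable _ A].
apply: (measure_unique C (fun=> setT) _ _ _ _
  (giry_map mxy (mu : subprobability Omega R))) => //.
- exact: measurable_prod_measurableType.
- move=> _ _ [U1 mU1 [V1 mV1 <-]] [U2 mU2 [V2 mV2 <-]].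
  rewrite -setXI; exists (U1 `&` U2); first exact: measurableI.
  by exists (V1 `&` V2) => //; exact: measurableI.
- by move=> _; exists setT => //; exists setT => //; rewrite setXTT.
- by apply/seteqP; split=> // z _; exists 0%N.
- move=> _ [U mU [V mV <-]].
  rewrite [RHS](mixtureE mu k mx mid (measurableX mU mV)).
  transitivity (mu (x @^-1` U `&` y @^-1` V)) => //.
  rewrite law// [LHS]integral_mkcond; apply: eq_integral => w _.
  rewrite patchE; case: ifPn => [/set_mem/= xU|/negP xU].
    congr (k (x w) _); apply/seteqP; split => [a Va|a []//=].
    by split.
  rewrite (_ : _ @^-1` _ = set0) ?measure0//.
  apply/seteqP; split => // a [/= xwU _]; apply: xU.
  by rewrite inE.
- move=> _; apply: le_lt_trans (ltry 1).
  exact: (@sprobability_setT _ _ _ (giry_map mxy (mu : subprobability Omega R))).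
Qed.

End markov_transitions.

(** * Monotonicity of extended integrals *)

Section integral_monotonicity.
Context (R : realType) d (T : measurableType d) (mu : {measure set T -> \bar R}).
Local Open Scope ereal_scope.

(** Positive and negative parts are compared separately, so infinite integrals are allowed, as may
    occur for the logarithm of a density. *)
Lemma ae_le_integral (f g : T -> \bar R) :
  measurable_fun [set: T] f -> measurable_fun [set: T] g ->
  (\forall x \ae mu, f x <= g x) -> \int[mu]_x f x <= \int[mu]_x g x.
Proof.
move=> mf mg fg; rewrite integralE [leRHS]integralE; apply: leeB.
- apply: ae_ge0_le_integral => //; try exact: measurable_funepos.
  apply: filterS fg => x fgx _.
  by rewrite !funeposE ge_max !le_max lexx orbT andbT fgx.
- apply: ae_ge0_le_integral => //; try exact: measurable_funeneg.
  apply: filterS fg => x fgx _.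
  by rewrite !funenegE ge_max !le_max lexx orbT andbT leeN2 fgx.
Qed.

(* No measurability is needed: the integral of a nonnegative function is the
   supremum over the simple functions below it. *)
Lemma ge0_le_lower_integral (f g : T -> \bar R) :
  (forall x, 0 <= f x) -> (forall x, f x <= g x) ->
  \int[mu]_x f x <= \int[mu]_x g x.
Proof.
move=> f0 fg; have g0 x : 0 <= g x by exact: le_trans (fg x).
rewrite !ge0_integralTE//; apply: ereal_sup_le => _ [h hf <-].
by exists h => // x; exact: le_trans (fg x).
Qed.

End integral_monotonicity.

(** * Lower bounds on the Kullback-Leibler divergence *)

Section KL_lower_bounds.
Context (R : realType) d (T : measurableType d) (P Q : probability T R).

(* Donsker-Varadhan: with [p = dP/dQ], integrate the pointwise inequality
   [ln p >= phi + 1 - e^phi / p] against P. *)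
Lemma KL_ge_variational B (phi : T -> R) : bmeas B phi ->
  ((\int[P]_x phi x + 1 - \int[Q]_x expR (phi x))%:E <= KL P Q)%E.
Proof.
move=> bphi; have [mphi phiB] := bphi.
rewrite /KL; case: asboolP => [PQ|_]; last by rewrite leey.
set rn := Radon_Nikodym _ _.
(* A version of dP/dQ that is nonnegative and finite everywhere; absolute continuity makes it agree
   with [rn] P-almost everywhere. *)
pose f := Radon_Nikodym_SigmaFinite.f P Q.
have mf : measurable_fun [set: T] f.
  exact: measurable_int (Radon_Nikodym_SigmaFinite.f_integrable PQ).
have f0 x : (0 <= f x)%E by exact: Radon_Nikodym_SigmaFinite.f_ge0.
have ffin x : f x \is a fin_num by exact: Radon_Nikodym_SigmaFinite.f_fin_num.
have mrn : measurable_fun [set: T] rn.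
  have := Radon_Nikodym_integrable (nu := charge_of_finite_measure P) PQ.
  exact: measurable_int.
have rnfin x : rn x \is a fin_num by exact: Radon_Nikodym_fin_num.
have frn : ae_eq P [set: T] f rn.
  apply: (null_dominates_ae_eq measurableT PQ).
  exact: ae_eq_Radon_Nikodym_SigmaFinite.
pose p x := fine (f x).
have fE x : f x = (p x)%:E by rewrite fineK.
have mp : measurable_fun [set: T] p by apply: measurableT_comp.
have p_gt0 : \forall x \ae P, 0 < p x.
  pose N := [set x | p x <= 0].
  have mN : measurable N.
    have := measurable_fun_ler mp (@measurable_cst _ _ T R setT 0).
    move=> /(_ measurableT [set true]); rewrite setTI; exact.
  exists N; split => //; last by move=> x /= /negP; rewrite -leNgt.
  (* The P-mass of [N] is the Q-integral over [N] of the density, which vanishes there. *)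
  rewrite (Radon_Nikodym_SigmaFinite.f_integral PQ mN).
  apply: integral0_eq => x Nx; apply/eqP; rewrite eq_le f0 andbT.
  by rewrite -/f fE lee_fin.
(* This is [e^phi / p], set to 0 where [p] vanishes. Under change of variables the factor [p]
   cancels, so its P-mean is at most the Q-mean of [e^phi]. *)
pose u x := if 0 < p x then expR (phi x - ln (p x)) else 0.
have u0 x : 0 <= u x by rewrite /u; case: ifPn => // _; exact: expR_ge0.
have mu : measurable_fun [set: T] u.
  apply: measurable_fun_ifT => //; first exact: measurable_fun_ltr.
  apply: measurableT_comp => //; apply: measurable_funB => //.
  exact: measurableT_comp.
have mexp : bmeas (expR B) (fun x => expR (phi x)).
  split; first exact: measurableT_comp.
  by move=> x; rewrite ger0_norm ?expR_ge0// ler_expR (le_trans (ler_norm _)).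
have intu : (\int[P]_x (u x)%:E <= (\int[Q]_x expR (phi x))%:E)%E.
  rewrite -(Radon_Nikodym_SigmaFinite.change_of_variables PQ)//; last first.
    exact/measurable_EFinP.
  rewrite (bmeas_EFin Q mexp); apply: ge0_le_integral => //.
  - by move=> x _; rewrite mule_ge0// lee_fin.
  - by apply: emeasurable_funM => //; exact/measurable_EFinP.
  - by apply/measurable_EFinP; case: mexp.
  - move=> x _; rewrite -/f fE -EFinM lee_fin /u; case: ifPn => [p0|_].
      by rewrite expRB lnK// divfK// gt_eqF.
    by rewrite mul0r expR_ge0.
have iu : P.-integrable [set: T] (EFin \o u).
  apply/integrableP; split; first exact/measurable_EFinP.
  under eq_integral => x _ do rewrite gee0_abs ?lee_fin//.
  exact: le_lt_trans intu (ltry _).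
have bphi1 := bmeasD bphi (@bmeas_cst R _ T 1).
apply: (@le_trans _ _ (\int[P]_x (phi x + 1 - u x)%:E)%E).
  rewrite integralB_EFin//; last exact: bmeas_integrable bphi1.
  rewrite -(bmeas_EFin P bphi1) (bmeas_RintegralD P bphi (bmeas_cst _ 1)).
  by rewrite (probability_Rintegral_cst P) EFinB leeB.
apply: ae_le_integral.
- apply/measurable_EFinP; apply: measurable_funB => //.
  exact: measurable_funD.
- have -> : (fun x => lne (rn x)) = (fun x =>
      if fine (rn x) <= 0 then -oo%E else (ln (fine (rn x)))%:E).
    by apply/funext => x; rewrite -[in LHS](fineK (rnfin x)).
  have mfrn : measurable_fun [set: T] (fun x => fine (rn x)).
    exact: measurableT_comp.
  apply: measurable_fun_ifT => //.
    exact: measurable_fun_ler.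
  by apply/measurable_EFinP; exact: measurableT_comp.
- apply: filterS2 frn p_gt0 => x /(_ I) <- px; rewrite fE lne_EFin// lee_fin /u px.
  have := expR_ge1Dx (phi x - ln (p x)); lra.
Qed.

(** From [e^y (1 - y) <= e^y e^(-y) = 1] and [(1 + y + 2 y^2) (1 - y) = 1 + y^2 (1 - 2 y)], which is
    at least 1 when [y <= 1/2]. *)
Lemma expR_le_quadratic (y : R) : `|y| <= 2^-1 -> expR y <= 1 + y + 2 * y ^+ 2.
Proof.
rewrite ler_norml => /andP[y1 y2].
have y0 : 0 < 1 - y by lra.
have : expR y * (1 - y) <= 1.
  rewrite -[leRHS](expRxMexpNx_1 y) ler_wpM2l ?expR_ge0//.
  exact: expR_ge1Dx.
rewrite -ler_pdivlMr// => /le_trans; apply.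
rewrite ler_pdivrMr//; nra.
Qed.

(** The variational bound at [phi = t g], with the exponential moment under [Q] controlled by the
    quadratic bound on [expR]. *)
Lemma KL_ge_quadratic (g : T -> R) (t : R) : bmeas 1 g -> `|t| <= 2^-1 ->
  ((t * (\int[P]_x g x - \int[Q]_x g x) - 2 * t ^+ 2)%:E <= KL P Q)%E.
Proof.
move=> bg t2; have [mg g1] := bg.
have btg := bmeasZ t bg.
have tg2 x : `|t * g x| <= 2^-1.
  by rewrite normrM (le_trans _ t2)// ler_piMr.
apply: le_trans (KL_ge_variational btg); rewrite lee_fin.
rewrite (bmeas_RintegralZl P t bg).
suff : \int[Q]_x expR (t * g x) <= 1 + t * (\int[Q]_x g x) + 2 * t ^+ 2 by lra.
have b1 := bmeasD (@bmeas_cst R _ T (1 + 2 * t ^+ 2)) btg.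
rewrite (_ : _ + _ + _ = \int[Q]_x (1 + 2 * t ^+ 2 + t * g x)); last first.
  rewrite (bmeas_RintegralD Q (bmeas_cst _ (1 + 2 * t ^+ 2)) btg).
  by rewrite (probability_Rintegral_cst Q) (bmeas_RintegralZl Q t bg); lra.
have [mtg _] := btg.
have be : bmeas (expR `|t|) (fun x => expR (t * g x)).
  split; first exact: measurableT_comp.
  move=> x; rewrite ger0_norm ?expR_ge0// ler_expR (le_trans (ler_norm _))//.
  by rewrite normrM ler_piMr.
apply: (bmeas_le_Rintegral Q be b1) => x.
apply: le_trans (expR_le_quadratic (tg2 x)) _.
have : (t * g x) ^+ 2 <= t ^+ 2.
  rewrite exprMn ler_piMr ?sqr_ge0//.
  by have := g1 x; rewrite ler_norml => /andP[]; nra.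
by rewrite /=; lra.
Qed.

Lemma KL_ge0 : (0 <= KL P Q)%E.
Proof.
have := @KL_ge_quadratic (cst 0) 0; rewrite mul0r expr0n/= mulr0 subr0; apply.
- by split=> [|x]; [exact: measurable_cst|rewrite normr0].
- by rewrite normr0 invr_ge0.
Qed.

End KL_lower_bounds.

(** * Mean difference of two policies against their mean divergence *)

Section policy_gap.
Context (R : realType) dS dA (S : measurableType dS) (A : measurableType dA).
Variables (pi1 pi2 : policy R S A) (rho : probability S R).

Definition policy_gap (g : S * A -> R) (s : S) : R :=
  \int[policy_at pi1 s]_a g (s, a) - \int[policy_at pi2 s]_a g (s, a).

Lemma bmeas_policy_gap B g : bmeas B g -> bmeas (B + B) (policy_gap g).
Proof. by move=> bg; apply: bmeasB; exact: bmeas_kernel. Qed.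

Let averaged_KL : \bar R :=
  (\int[rho]_s KL (policy_at pi1 s) (policy_at pi2 s))%E.

(* [KL] need not be measurable in the state, but [policy_gap g] is; the
   quadratic lower bound is integrated with [t] a quarter of the mean gap. *)
Lemma sqr_mean_policy_gap_le g : bmeas 1 g ->
  (((\int[rho]_s policy_gap g s) ^+ 2 / 8)%:E <= averaged_KL)%E.
Proof.
move=> bg; have bD := bmeas_policy_gap bg.
set m := \int[rho]_s _.
(* The maximiser of [t m - 2 t^2], with value [m^2 / 8]; it is admissible because [|m| <= 2]. *)
pose t := m / 4.
have t2 : `|t| <= 2^-1.
  have := bmeas_norm_Rintegral rho bD; rewrite -/m /t !ler_norml => /andP[? ?].
  by apply/andP; split; lra.
pose h s := t * policy_gap g s - 2 * t ^+ 2.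
have btD := bmeasZ t bD.
have bh := bmeasB btD (bmeas_cst _ (2 * t ^+ 2)).
have [mh _] := bh.
(* Truncating at 0 gives a nonnegative minorant of the divergence, as [ge0_le_lower_integral]
   requires. *)
apply: (@le_trans _ _ (\int[rho]_s (Num.max (h s) 0)%:E)%E); last first.
  apply: ge0_le_lower_integral => s; first by rewrite lee_fin le_max lexx orbT.
  rewrite EFin_max ge_max KL_ge0 andbT; apply: KL_ge_quadratic => //.
  by apply: bmeas_comp bg; exact: pair1_measurable.
apply: (@le_trans _ _ (\int[rho]_s (h s)%:E)%E).
  rewrite -(bmeas_EFin rho bh) lee_fin (bmeas_RintegralB rho btD (bmeas_cst _ _)).
  rewrite (bmeas_RintegralZl rho t bD) (probability_Rintegral_cst rho) -/m /t.
  by lra.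
apply: ae_le_integral.
- exact/measurable_EFinP.
- by apply/measurable_EFinP; exact: measurable_maxr.
- by apply: aeW => s; rewrite lee_fin le_max lexx.
Qed.

(** Rescaling [g] by [B^-1] reduces to the bound 1; the constant arises as [sqrt 8 = 2 sqrt 2]. *)
Lemma mean_policy_gap_le B g : 0 <= B -> bmeas B g ->
  (`|\int[rho]_s policy_gap g s|%:E <=
   (2 * Num.sqrt 2 * B)%:E * sqrte averaged_KL)%E.
Proof.
(* For [B = 0] the rescaling is meaningless; both sides are then 0, even for an infinite divergence,
   since [0 * +oo = 0]. *)
rewrite le_eqVlt => /predU1P[<-|B0] bg.
  have bD := bmeas_policy_gap bg.
  have := bmeas_norm_Rintegral rho bD; rewrite addr0 -lee_fin => /le_trans; apply.
  by rewrite mulr0 mul0e.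
have bg1 : bmeas 1 (fun z => B^-1 * g z).
  by have := bmeasZ B^-1 bg; rewrite ger0_norm ?invr_ge0 ?ltW// mulVf ?gt_eqF.
have := sqr_mean_policy_gap_le bg1.
have -> : policy_gap (fun z => B^-1 * g z) = (fun s => B^-1 * policy_gap g s).
  apply/funext => s; have bgs : bmeas B (fun a => g (s, a)).
    by apply: bmeas_comp bg; exact: pair1_measurable.
  by rewrite /policy_gap (bmeas_RintegralZl (policy_at pi1 s) _ bgs)
    (bmeas_RintegralZl (policy_at pi2 s) _ bgs) -mulrBr.
rewrite (bmeas_RintegralZl rho _ (bmeas_policy_gap bg)).
set m := \int[rho]_s _.
have C0 : 0 < 2 * Num.sqrt 2 * B by rewrite !mulr_gt0// sqrtr_gt0.
case: averaged_KL => [P| |]; last by rewrite leeNy_eq.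
- rewrite lee_fin => mP; rewrite /= -EFinM lee_fin.
  have P0 : 0 <= P by apply: le_trans mP; rewrite divr_ge0 ?sqr_ge0.
  rewrite -(@ler_pXn2r _ 2) ?nnegrE ?normr_ge0 ?(mulr_ge0 (ltW C0)) ?sqrtr_ge0//.
  rewrite real_normK ?num_real// !exprMn !sqr_sqrtr//.
  have -> : m ^+ 2 = B ^+ 2 * ((B^-1 * m) ^+ 2).
    by rewrite exprMn mulrA -exprMn mulfV ?gt_eqF// expr1n mul1r.
  have : B ^+ 2 * ((B^-1 * m) ^+ 2 / 8) <= B ^+ 2 * P by rewrite ler_wpM2l ?sqr_ge0.
  by move: (B ^+ 2) ((B^-1 * m) ^+ 2) => X Y; lra.
- by move=> _; rewrite /= gt0_muley ?lte_fin// leey.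
Qed.

End policy_gap.

(** * Discounted series, their expectations and the discounted state law *)

Section discounted_series.
Context (R : realType) (gamma : R).
Hypothesis gamma_ge0 : 0 <= gamma.
Hypothesis gamma_lt1 : gamma < 1.

Let gamma_norm : `|gamma| < 1. Proof. by rewrite ger0_norm. Qed.
Let gamma1_gt0 : 0 < 1 - gamma. Proof. by rewrite subr_gt0. Qed.

Lemma discounted_series_le B (u : nat -> R) n : (forall t, `|u t| <= B) ->
  `|series (fun t => gamma ^+ t * u t) n| <= B / (1 - gamma).
Proof.
move=> uB; have B0 : 0 <= B by exact: le_trans (uB 0%N).
apply: (@le_trans _ _ (series (geometric B gamma) n)).
  rewrite /series/= (le_trans (ler_norm_sum _ _ _))// ler_sum// => t _.
  by rewrite normrM ger0_norm ?exprn_ge0// mulrC ler_wpM2r ?exprn_ge0.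
rewrite geometric_seriesE ?lt_eqF//= ler_wpM2r ?invr_ge0 ?(ltW gamma1_gt0)//.
by rewrite ler_piMr// gerBl exprn_ge0.
Qed.

Lemma is_cvg_discounted_series B (u : nat -> R) : (forall t, `|u t| <= B) ->
  cvgn (series (fun t => gamma ^+ t * u t)).
Proof.
move=> uB; have B0 : 0 <= B by exact: le_trans (uB 0%N).
apply: normed_cvg; apply: (@series_le_cvg _ _ (geometric B gamma)).
- by move=> t; exact: normr_ge0.
- by move=> t; exact: geometric_ge0.
- move=> t; rewrite /geometric/= normrM ger0_norm ?exprn_ge0// mulrC.
  by rewrite ler_wpM2r ?exprn_ge0.
- exact: is_cvg_geometric_series.
Qed.

Lemma discounted_cvg0 B (u : nat -> R) : (forall t, `|u t| <= B) ->
  gamma ^+ t * u t @[t --> \oo] --> (0 : R).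
Proof. by move=> uB; apply: cvg_series_cvg_0; exact: is_cvg_discounted_series uB. Qed.

(** All partial sums are bounded by [B / (1 - gamma)], so dominated convergence exchanges limit and
    expectation. *)
Lemma discounted_expectation_cvg dO (Omega : measurableType dO)
    (mu : probability Omega R) B (u : nat -> Omega -> R) :
  (forall t, bmeas B (u t)) ->
  series (fun t => gamma ^+ t * \int[mu]_w u t w) n @[n --> \oo] -->
  fine ('E_mu[fun w => limn (series (fun t => gamma ^+ t * u t w)%R)])%E.
Proof.
move=> bu; rewrite unlock.
pose v n w := series (fun t => gamma ^+ t * u t w) n.
have bv n : bmeas (B / (1 - gamma)) (v n).
  split; last by move=> w; apply: discounted_series_le => t; case: (bu t).
  rewrite (_ : v n = fun w => \sum_(0 <= t < n) gamma ^+ t * u t w)//.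
  apply: measurable_sum => t; apply: measurable_funM => //.
  by case: (bu t).
have -> : series (fun t => gamma ^+ t * \int[mu]_w u t w) =
    fun n => fine (\int[mu]_w (v n w)%:E)%E.
  apply/funext; elim=> [|n IH].
    rewrite /series/= big_geq// (_ : v 0%N = cst 0) ?integral0//.
    by apply/funext => w; rewrite /v /series/= big_geq.
  rewrite seriesSr IH -[RHS]/(\int[mu]_w v n.+1 w).
  rewrite (_ : v n.+1 = fun w => v n w + gamma ^+ n * u n w).
    rewrite (bmeas_RintegralD mu (bv n) (bmeasZ _ (bu n))).
    by rewrite (bmeas_RintegralZl mu _ (bu n)).
  by apply/funext => w; rewrite /v seriesSr.
have vcvg w : v n w @[n --> \oo] --> limn (series (fun t => gamma ^+ t * u t w)).
  by apply: (@is_cvg_discounted_series B) => t; case: (bu t).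
have bW : bmeas (B / (1 - gamma))
    (fun w => limn (series (fun t => gamma ^+ t * u t w))).
  split.
    apply: (@measurable_fun_cvg _ _ _ _ v) => // n; by case: (bv n).
  move=> w; rewrite ler_norml; apply/andP; split.
    apply: limr_ge; first exact: vcvg.
    by apply: nearW => n; have [_ /(_ w)] := bv n; rewrite ler_norml => /andP[].
  apply: limr_le; first exact: vcvg.
  by apply: nearW => n; have [_ /(_ w)] := bv n; rewrite ler_norml => /andP[].
apply: fine_cvg; rewrite -[X in _ --> X]/(EFin (fine _)) fineK; last first.
  by apply: integrable_fin_num => //; exact: bmeas_integrable bW.
apply: (@dominated_cvg _ _ _ mu _ measurableT (fun n w => (v n w)%:E) _
  (fun=> (B / (1 - gamma))%:E)) => //.
- by move=> n; apply/measurable_EFinP; case: (bv n).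
- by move=> w _; apply: cvg_EFin; [exact: nearW|exact: vcvg].
- exact: (bmeas_integrable mu (bmeas_cst _ (B / (1 - gamma)))).
- by move=> n w _; rewrite lee_fin; case: (bv n).
Qed.

(** [rho] is the countable sum of the laws of [x t] weighted by [(1 - gamma) gamma^t]. Integrating
    the nonnegative [f + B] against this sum term by term and removing [B] gives the limit. *)
Lemma discounted_law_cvg dO dS (Omega : measurableType dO)
    (S : measurableType dS) (mu : probability Omega R) (x : nat -> Omega -> S)
    (rho : probability S R) B (f : S -> R) :
  (forall t, measurable_fun [set: Omega] (x t)) ->
  (forall U, measurable U -> rho U = ((1 - gamma)%:E *
    \sum_(0 <= t <oo) (gamma ^+ t)%:E * mu (x t @^-1` U))%E) ->
  bmeas B f ->
  (1 - gamma) * series (fun t => gamma ^+ t * \int[mu]_w f (x t w)) n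
    @[n --> \oo] --> \int[rho]_s f s.
Proof.
move=> mx rhoE bf.
pose c t : R := (1 - gamma) * gamma ^+ t.
have c0 t : 0 <= c t by rewrite mulr_ge0 ?exprn_ge0// ltW.
have bg := bmeasD bf (bmeas_cst _ B).
have g0 := bmeas_shift_ge0 bf.
pose G t := \int[mu]_w f (x t w) + B.
have GE t : (G t)%:E = (\int[mu]_w (f (x t w) + B)%:E)%E.
  rewrite -(bmeas_EFin mu (bmeas_comp (mx t) bg)).
  rewrite (bmeas_RintegralD mu (bmeas_comp (mx t) bf) (bmeas_cst _ B)).
  by rewrite (probability_Rintegral_cst mu).
have G0 t : 0 <= G t.
  by rewrite -lee_fin GE integral_ge0// => w _; rewrite lee_fin.
pose m t : {measure set S -> \bar R} :=
  mscale (NngNum (c0 t)) (giry_map (mx t) (mu : subprobability Omega R)).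
have rhoG : ((\int[rho]_s f s + B)%:E = \sum_(0 <= t <oo) (c t * G t)%:E)%E.
  rewrite -[in LHS](probability_Rintegral_cst rho B).
  rewrite -(bmeas_RintegralD rho bf (bmeas_cst _ B)) (bmeas_EFin rho bg).
  transitivity (\int[mseries m 0]_s (f s + B)%:E)%E.
    apply: eq_measure_integral => U mU _.
    rewrite [LHS](rhoE U mU) -nneseriesZl//; last first.
      by move=> t _; rewrite mule_ge0// lee_fin exprn_ge0.
    apply: eq_eseriesr => t _.
    by rewrite muleA -EFinM.
  have mg : measurable_fun [set: S] (fun s => (f s + B)%:E).
    by apply/measurable_EFinP; case: bg.
  rewrite ge0_integral_measure_series//; last by move=> s _; rewrite lee_fin.
  apply: eq_eseriesr => t _.
  rewrite ge0_integral_mscale//; last by move=> s _; rewrite lee_fin.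
  rewrite [RHS]EFinM GE; congr (_ * _)%E.
  apply: (@giry_int_map _ _ _ _ _ _ (mx t) (mu : subprobability Omega R) _ mg).
  by move=> s; rewrite lee_fin.
have cvgG : series (fun t => c t * G t) n @[n --> \oo] --> \int[rho]_s f s + B.
  have : (\sum_(0 <= t < n) (c t * G t)%:E)%E @[n --> \oo] -->
      (\int[rho]_s f s + B)%:E.
    rewrite rhoG; apply: is_cvg_nneseries => t _ _.
    by rewrite lee_fin mulr_ge0.
  move=> /fine_cvg; apply: cvg_trans; apply: near_eq_cvg; apply: nearW => n /=.
  by rewrite sumEFin.
(* The weights [(1 - gamma) gamma^t] sum to 1, so the shift contributes exactly [B] in the limit. *)
have cvgc : (1 - gamma) * series (geometric 1 gamma) n * B @[n --> \oo] --> B.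
  rewrite [X in _ --> X](_ : _ = (1 - gamma) * (1 * (1 - gamma)^-1) * B).
    by apply: cvgMr_tmp; apply: cvgMl_tmp; exact: cvg_geometric_series.
  by field; rewrite gt_eqF.
rewrite -[X in _ --> X](addrK B).
apply: cvg_trans (cvgB cvgG cvgc); apply: near_eq_cvg.
apply: nearW => n /=; rewrite /series/= /G /c !fctE/= !mulr_sumr mulr_suml -sumrB.
apply: eq_bigr => t _; rewrite mul1r; ring.
Qed.

End discounted_series.

(** * Bellman operators and value iteration *)

Section bellman.
Context (R : realType) dS dA (S : measurableType dS) (A : measurableType dA).
Variables (P : policy R (S * A)%type S) (gamma : R) (r : S * A -> R) (Rmax : R).
Hypothesis gamma_ge0 : 0 <= gamma.
Hypothesis gamma_lt1 : gamma < 1.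
Hypothesis bounded_reward : bmeas Rmax r.

Let gamma1_gt0 : 0 < 1 - gamma. Proof. by rewrite subr_gt0. Qed.

Definition action_value (V : S -> R) (z : S * A) : R :=
  r z + gamma * \int[policy_at P z]_s V s.

Definition bellman (pi : policy R S A) (V : S -> R) (s : S) : R :=
  \int[policy_at pi s]_a action_value V (s, a).

Definition value_iteration pi n : S -> R := iter n (bellman pi) (fun=> 0).

Lemma bmeas_next_value B V : bmeas B V ->
  bmeas B (fun z : S * A => \int[policy_at P z]_s V s).
Proof.
move=> bV; apply: (bmeas_kernel P (g := fun z => V z.2)).
by apply: bmeas_comp bV; exact: measurable_snd.
Qed.

Lemma bmeas_action_value B V : bmeas B V ->
  bmeas (Rmax + gamma * B) (action_value V).
Proof.
move=> bV; apply: bmeasD => //.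
by have := bmeasZ gamma (bmeas_next_value bV); rewrite ger0_norm.
Qed.

Lemma bmeas_bellman pi B V : bmeas B V ->
  bmeas (Rmax + gamma * B) (bellman pi V).
Proof. by move=> bV; apply: bmeas_kernel; exact: bmeas_action_value. Qed.

(** [Rmax / (1 - gamma)] is the fixed point of the recursion on bounds in [bmeas_bellman], hence a
    uniform bound for all iterates started at 0. *)
Lemma value_bound_fixed : Rmax + gamma * (Rmax / (1 - gamma)) = Rmax / (1 - gamma).
Proof. by field; rewrite gt_eqF. Qed.

Lemma bmeas_value_iteration pi n :
  (0 <= Rmax) -> bmeas (Rmax / (1 - gamma)) (value_iteration pi n).
Proof.
move=> Rmax0; elim: n => [|n IH] /=.
  split=> [|s]; first exact: measurable_cst.
  by rewrite normr0 divr_ge0// ltW.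
by rewrite -value_bound_fixed; exact: bmeas_bellman.
Qed.

(** Contraction in sup norm: the rewards cancel, and averaging over actions and next states does not
    increase the distance. *)
Lemma bellmanB pi (B C e : R) (V W : S -> R) : bmeas B V -> bmeas C W ->
  (forall s, `|V s - W s| <= e) ->
  forall s, `|bellman pi V s - bellman pi W s| <= gamma * e.
Proof.
move=> bV bW VWe s.
have bVW : bmeas e (fun s => V s - W s) by split=> //; case: (bmeasB bV bW).
have bs (B' : R) (g : S * A -> R) : bmeas B' g -> bmeas B' (fun a => g (s, a)).
  by apply: bmeas_comp; exact: pair1_measurable.
rewrite /bellman -(bmeas_RintegralB (policy_at pi s)
  (bs _ _ (bmeas_action_value bV)) (bs _ _ (bmeas_action_value bW))).
have -> : (fun a => action_value V (s, a) - action_value W (s, a)) =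
    fun a => gamma * \int[policy_at P (s, a)]_s' (V s' - W s').
  apply/funext => a; rewrite /action_value.
  rewrite (bmeas_RintegralB (policy_at P (s, a)) bV bW); ring.
have := bmeasZ gamma (bs _ _ (bmeas_next_value bVW)).
by rewrite (ger0_norm gamma_ge0); exact: bmeas_norm_Rintegral.
Qed.

(** The first residual is at most [Rmax], being the mean reward; each further iteration contracts it
    by [gamma]. *)
Lemma value_iteration_residual pi n : 0 <= Rmax -> forall s,
  `|bellman pi (value_iteration pi n) s - value_iteration pi n s|
  <= gamma ^+ n * Rmax.
Proof.
move=> Rmax0; elim: n => [|n IH] s.
  rewrite expr0 mul1r subr0.
  have b0 : bmeas (R := R) (T := S) 0 (fun=> 0).
    by split=> [|?]; [exact: measurable_cst|rewrite normr0].
  by have [_ /(_ s)] := bmeas_bellman pi b0; rewrite mulr0 addr0.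
rewrite exprS -mulrA; apply: bellmanB => //; last exact: bmeas_value_iteration.
exact: (bmeas_value_iteration pi n.+1).
Qed.

End bellman.

(** * Returns along a trajectory *)

Section trajectory_returns.
Context (R : realType) dS dA (S : measurableType dS) (A : measurableType dA).
Context (K : nat) (F : federation R S A K) (k : 'I_K) (pi : policy R S A).
Variables (tr : trajectory F k pi) (r : S * A -> R) (Rmax : R).
Hypothesis bounded_reward : bmeas Rmax r.

Local Notation gamma := (discount F).
Local Notation mu := (law tr).
Local Notation st := (state tr).
Local Notation ac := (action tr).
Local Notation T_ := (bellman (trans F k) gamma r).

Let gamma_ge0 : 0 <= gamma. Proof. exact: discount_ge0. Qed.
Let gamma_lt1 : gamma < 1. Proof. exact: discount_lt1. Qed.

Let mst t : measurable_fun [set: sample tr] (st t).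
Proof. exact: measurable_state. Qed.

Let mac t : measurable_fun [set: sample tr] (ac t).
Proof. exact: measurable_action. Qed.

Let mst_ac t : measurable_fun [set: sample tr] (fun w => (st t w, ac t w)).
Proof. exact: measurable_fun_pair. Qed.

Lemma trajectory_init B V : bmeas B V ->
  \int[mu]_w V (st 0%N w) = \int[init F]_s V s.
Proof.
move=> bV; have [mV _] := bV.
have mV0 : measurable_fun [set: S] (EFin \o V) by exact/measurable_EFinP.
rewrite /Rintegral; congr fine.
have := integral_pushforward (mst 0) mV0
  (bmeas_integrable mu (bmeas_comp (mst 0) bV)) measurableT.
rewrite preimage_setT => <-.
by apply: eq_measure_integral => U mU _; exact: (state0_law tr).
Qed.

(** Cylinders constrained only at time [t] turn [action_law] into the rectangle condition of
    [joint_disintegration]. *)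
Lemma trajectory_action B g t : bmeas B g ->
  \int[mu]_w g (st t w, ac t w) =
  \int[mu]_w \int[policy_at pi (st t w)]_a g (st t w, a).
Proof.
apply: joint_disintegration => // U V mU mV.
pose Us i := if i == t then U else setT.
pose Vs i := if i == t then V else setT.
have mUs i : measurable (Us i) by rewrite /Us; case: ifP.
have mVs i : measurable (Vs i) by rewrite /Vs; case: ifP.
have := action_law tr t mUs mVs.
have -> : history st ac Us Vs t = st t @^-1` U.
  apply/seteqP; split => [w [/(_ t (leqnn t))]|w Uw].
    by rewrite /Us eqxx.
  split=> i it; first by rewrite /Us; case: eqP => // ->.
  by rewrite /Vs ltn_eqF.
by rewrite /Vs eqxx.
Qed.

Lemma trajectory_state B V t : bmeas B V ->
  \int[mu]_w V (st t.+1 w) =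
  \int[mu]_w \int[policy_at (trans F k) (st t w, ac t w)]_s V s.
Proof.
apply: marginal_disintegration => // U mU.
pose Us i := if i == t.+1 then U else setT.
have mUs i : measurable (Us i) by rewrite /Us; case: ifP.
have := state_law tr t mUs (fun=> measurableT).
have -> : history st ac Us (fun=> setT) t.+1 = st t.+1 @^-1` U.
  apply/seteqP; split => [w [/(_ t.+1 (leqnn _))]|w Uw].
    by rewrite /Us eqxx.
  by split=> i it //; rewrite /Us; case: eqP => // ->.
(* [Us] constrains only the index [t.+1], which the history up to [t] does not reach. *)
have -> : history st ac Us (fun=> setT) t `&` ac t @^-1` setT = setT.
  apply/seteqP; split => // w _; split => //; split=> i it //.
  by rewrite /Us ltn_eqF.
by rewrite /Us eqxx.
Qed.

(** Averaging first over the next state, then over the action given the state: one step of the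
    telescoping. *)
Lemma trajectory_bellman B V t : bmeas B V ->
  \int[mu]_w r (st t w, ac t w) + gamma * \int[mu]_w V (st t.+1 w) =
  \int[mu]_w T_ pi V (st t w).
Proof.
move=> bV; rewrite (trajectory_state t bV).
have bn := bmeas_next_value (trans F k) bV.
have ba := bmeas_action_value (trans F k) gamma_ge0 bounded_reward bV.
rewrite -(bmeas_RintegralZl mu gamma (bmeas_comp (mst_ac t) bn)).
rewrite -(bmeas_RintegralD mu (bmeas_comp (mst_ac t) bounded_reward)
  (bmeasZ gamma (bmeas_comp (mst_ac t) bn))).
exact: trajectory_action ba.
Qed.

Definition trajectory_return : R := fine ('E_mu[fun w =>
  limn (series (fun t => gamma ^+ t * r (st t w, ac t w)))%R])%E.

(** The partial sum up to [n] is the expected discounted reward before time [n], plus [gamma^n]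
    times the mean of [V] at time [n], minus its mean at time 0; the middle term tends to 0. *)
Lemma return_telescope B V : bmeas B V ->
  series (fun t => gamma ^+ t * \int[mu]_w (T_ pi V (st t w) - V (st t w))) n
    @[n --> \oo] --> trajectory_return - \int[init F]_s V s.
Proof.
move=> bV.
have bT := bmeas_bellman (trans F k) gamma_ge0 bounded_reward pi bV.
have bVt t := bmeas_comp (mst t) bV.
have cvgJ := discounted_expectation_cvg gamma_ge0 gamma_lt1 (mu := mu)
  (fun t => bmeas_comp (mst_ac t) bounded_reward).
have cvg0 := discounted_cvg0 gamma_ge0 gamma_lt1
  (fun t => bmeas_norm_Rintegral mu (bVt t)).
rewrite -(trajectory_init bV) -[X in _ --> X - _]addr0.
apply: cvg_trans (cvgB (cvgD cvgJ cvg0) (cvg_cst _)).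
apply: near_eq_cvg; apply: nearW => n; rewrite !fctE.
elim: n => [|n IH]; first by rewrite /series/= !big_geq// expr0 mul1r; ring.
rewrite !seriesSr -IH (bmeas_RintegralB mu (bmeas_comp (mst n) bT) (bVt n)).
rewrite -(trajectory_bellman n bV) exprS; ring.
Qed.

(** The telescoped series is dominated by the geometric series of ratio [gamma] with first term
    [e]. *)
Lemma return_approx (B e : R) (V : S -> R) : bmeas B V ->
  (forall s, `|T_ pi V s - V s| <= e) ->
  `|trajectory_return - \int[init F]_s V s| <= e / (1 - gamma).
Proof.
move=> bV Ve.
have bT := bmeas_bellman (trans F k) gamma_ge0 bounded_reward pi bV.
have be : bmeas e (fun s => T_ pi V s - V s) by split=> //; case: (bmeasB bT bV).
have telescope := return_telescope bV.
have bound n := discounted_series_le gamma_ge0 gamma_lt1 n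
  (fun t => bmeas_norm_Rintegral mu (bmeas_comp (mst t) be)).
rewrite -(cvg_lim (@Rhausdorff R) telescope) ler_norml; apply/andP; split.
  apply: limr_ge; first by apply/cvg_ex; eexists; exact: telescope.
  by apply: nearW => n; have := bound n; rewrite ler_norml => /andP[].
apply: limr_le; first by apply/cvg_ex; eexists; exact: telescope.
by apply: nearW => n; have := bound n; rewrite ler_norml => /andP[].
Qed.

(** [1 - gamma] times the telescoped series has two known limits, one from [return_telescope], the
    other from the discounted state law; they coincide. *)
Lemma return_bellman_gap B V (rho : probability S R) : bmeas B V ->
  (forall U, measurable U -> rho U = ((1 - gamma)%:E *
    \sum_(0 <= t <oo) (gamma ^+ t)%:E * mu (st t @^-1` U))%E) ->
  trajectory_return - \int[init F]_s V s =
  (1 - gamma)^-1 * \int[rho]_s (T_ pi V s - V s).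
Proof.
move=> bV rhoE.
have bT := bmeas_bellman (trans F k) gamma_ge0 bounded_reward pi bV.
have <- := cvg_lim (@Rhausdorff R)
  (discounted_law_cvg gamma_ge0 gamma_lt1 mst rhoE (bmeasB bT bV)).
have /(cvg_lim (@Rhausdorff R)) -> : (1 - gamma) *
    series (fun t => gamma ^+ t * \int[mu]_w (T_ pi V (st t w) - V (st t w))) n
      @[n --> \oo] --> (1 - gamma) * (trajectory_return - \int[init F]_s V s).
  by apply: cvgMl_tmp; exact: return_telescope bV.
by rewrite mulrA mulVf ?mul1r// gt_eqF// subr_gt0.
Qed.

End trajectory_returns.

(** * Performance difference of two policies *)

Section performance_gap.
Context (R : realType) dS dA (S : measurableType dS) (A : measurableType dA).
Context (K : nat) (F : federation R S A K) (k : 'I_K).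
Variables (r : S * A -> R) (Rmax : R).
Hypothesis Rmax_ge0 : 0 <= Rmax.
Hypothesis bounded_reward : bmeas Rmax r.

Local Notation gamma := (discount F).

Definition discounted_law (pi : policy R S A) (tr : trajectory F k pi)
    (rho : probability S R) :=
  forall U, measurable U -> rho U = ((1 - gamma)%:E *
    \sum_(0 <= t <oo) (gamma ^+ t)%:E * law tr (state tr t @^-1` U))%E.

Let gamma_ge0 : 0 <= gamma. Proof. exact: discount_ge0. Qed.
Let gamma_lt1 : gamma < 1. Proof. exact: discount_lt1. Qed.
Let gamma1_gt0 : 0 < 1 - gamma. Proof. by rewrite subr_gt0. Qed.

(** An approximate performance difference lemma. The Bellman residual of [pi1] at [V] is the policy
    gap of [Q] plus the residual of [pi2]. That second residual, and the distance of the return of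
    [pi2] from the initial mean of [V], each cost [gamma^n Rmax / (1 - gamma)]. *)
Lemma performance_difference (pi1 pi2 : policy R S A)
    (tr1 : trajectory F k pi1) (tr2 : trajectory F k pi2)
    (rho : probability S R) n : discounted_law tr1 rho ->
  `|trajectory_return tr1 r - trajectory_return tr2 r| <=
  (1 - gamma)^-1 * `|\int[rho]_s policy_gap pi1 pi2 (action_value (trans F k)
    gamma r (value_iteration (trans F k) gamma r pi2 n)) s| +
  gamma ^+ n * (2 * Rmax / (1 - gamma)).
Proof.
move=> rhoE; set V := value_iteration _ _ _ _ _; set Q := action_value _ _ _ V.
have bV : bmeas (Rmax / (1 - gamma)) V by exact: bmeas_value_iteration.
have bT pi := bmeas_bellman (trans F k) gamma_ge0 bounded_reward pi bV.
have Vres : forall s,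
    `|bellman (trans F k) gamma r pi2 V s - V s| <= gamma ^+ n * Rmax.
  exact: value_iteration_residual.
have bres : bmeas (gamma ^+ n * Rmax)
    (fun s => bellman (trans F k) gamma r pi2 V s - V s).
  by split=> //; case: (bmeasB (bT pi2) bV).
have bgap := bmeasB (bT pi1) (bT pi2).
have := return_bellman_gap bounded_reward bV rhoE.
have -> : \int[rho]_s (bellman (trans F k) gamma r pi1 V s - V s) =
    \int[rho]_s policy_gap pi1 pi2 Q s +
    \int[rho]_s (bellman (trans F k) gamma r pi2 V s - V s).
  rewrite -(bmeas_RintegralD rho bgap bres); apply: eq_Rintegral => s _.
  by rewrite addrA subrK.
have := return_approx tr2 bounded_reward bV Vres.
have := bmeas_norm_Rintegral rho bres.
set i2 := \int[rho]_s _; set i1 := \int[rho]_s _; set v := \int[_]_s _.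
move=> i2e J2 J1.
have -> : trajectory_return tr1 r - trajectory_return tr2 r =
    (1 - gamma)^-1 * i1 + (1 - gamma)^-1 * i2 - (trajectory_return tr2 r - v).
  by rewrite -mulrDr -J1; ring.
have i2e' : `|(1 - gamma)^-1 * i2| <= gamma ^+ n * Rmax / (1 - gamma).
  rewrite normrM ger0_norm ?invr_ge0 ?(ltW gamma1_gt0)// mulrC.
  by rewrite ler_wpM2r// invr_ge0 ltW.
have i1e : `|(1 - gamma)^-1 * i1| = (1 - gamma)^-1 * `|i1|.
  by rewrite normrM ger0_norm// invr_ge0 ltW.
rewrite -i1e (_ : gamma ^+ n * (2 * Rmax / (1 - gamma)) =
  gamma ^+ n * Rmax / (1 - gamma) + gamma ^+ n * Rmax / (1 - gamma)); last by ring.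
rewrite addrA; apply: le_trans (ler_normB _ _) _; apply: lerD => //.
by apply: le_trans (ler_normD _ _) _; exact: lerD.
Qed.

Lemma performance_gap_le (pi1 pi2 : policy R S A)
    (tr1 : trajectory F k pi1) (tr2 : trajectory F k pi2)
    (rho : probability S R) : discounted_law tr1 rho \/ discounted_law tr2 rho ->
  (`|trajectory_return tr1 r - trajectory_return tr2 r|%:E <=
   (2 * Num.sqrt 2 * Rmax / (1 - gamma) ^+ 2)%:E *
   sqrte (\int[rho]_s KL (policy_at pi1 s) (policy_at pi2 s)))%E.
Proof.
move=> rhoE; set J := `|_ - _|; set X := (\int[rho]_s _)%E.
have [Q bQ JQ] : exists2 Q : nat -> S * A -> R,
    forall n, bmeas (Rmax / (1 - gamma)) (Q n) &
    forall n, J <= (1 - gamma)^-1 * `|\int[rho]_s policy_gap pi1 pi2 (Q n) s| +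
      gamma ^+ n * (2 * Rmax / (1 - gamma)).
  pose Q pi n := action_value (trans F k) gamma r
    (value_iteration (trans F k) gamma r pi n).
  have bQ pi n : bmeas (Rmax / (1 - gamma)) (Q pi n).
    rewrite -value_bound_fixed//; apply: bmeas_action_value => //.
    exact: bmeas_value_iteration.
  (* The iterates belong to the policy other than the one generating [rho]. Exchanging the roles
     only changes the sign of the gap, so the divergence keeps its order of arguments. *)
  case: rhoE => rhoE.
    by exists (Q pi2) => // n; exact: performance_difference rhoE.
  exists (Q pi1) => // n.
  have bgap := bmeas_policy_gap pi2 pi1 (bQ pi1 n).
  have -> : policy_gap pi1 pi2 (Q pi1 n) =
      fun s => -1 * policy_gap pi2 pi1 (Q pi1 n) s.
    by apply/funext => s; rewrite mulN1r opprB.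
  rewrite (bmeas_RintegralZl rho _ bgap) mulN1r normrN /J distrC.
  exact: performance_difference rhoE.
have JX n : (J%:E <= (2 * Num.sqrt 2 * Rmax / (1 - gamma) ^+ 2)%:E * sqrte X +
    (gamma ^+ n * (2 * Rmax / (1 - gamma)))%:E)%E.
  have := JQ n; rewrite -lee_fin EFinD => /le_trans; apply; apply: leeD => //.
  have B0 : 0 <= Rmax / (1 - gamma) by rewrite divr_ge0// ltW.
  have gap := mean_policy_gap_le pi1 pi2 rho B0 (bQ n).
  rewrite EFinM; apply: le_trans (lee_wpmul2l _ gap) _.
    by rewrite lee_fin invr_ge0 ltW.
  (* One factor [1 / (1 - gamma)] comes from the discounted state law, the other from the bound on
     [Q n]. *)
  rewrite -/X muleA -EFinM le_eqVlt; apply/orP; left; apply/eqP; congr (_%:E * _)%E.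
  by field; rewrite gt_eqF.
apply/lee_addgt0Pr => e e0.
have : gamma ^+ n * (2 * Rmax / (1 - gamma)) @[n --> \oo] --> (0 : R).
  exact: (discounted_cvg0 gamma_ge0 gamma_lt1 (u := fun=> _) (fun=> lexx _)).
move=> /cvgrPdist_le /(_ _ e0) [n _ /(_ n (leqnn n))].
rewrite sub0r normrN => ne.
apply: le_trans (JX n) _; rewrite leeD2l// lee_fin.
exact: le_trans (ler_norm _) ne.
Qed.

End performance_gap.

(** * Averaging over the clients *)

Lemma le_mean_gap (R : realType) (K : nat) (x y : 'I_K -> R) (c : R)
    (z : 'I_K -> \bar R) : 0 <= c -> (forall k, 0 <= z k)%E ->
  (forall k, (x k)%:E <= (y k)%:E + c%:E * z k)%E ->
  ((K%:R^-1 * \sum_(k < K) x k)%:E - c%:E * ((K%:R^-1)%:E * \sum_(k < K) z k)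
   <= (K%:R^-1 * \sum_(k < K) y k)%:E)%E.
Proof.
move=> c0 z0 xyz.
have : ((K%:R^-1 * \sum_(k < K) x k)%:E <= (K%:R^-1 * \sum_(k < K) y k)%:E +
    c%:E * ((K%:R^-1)%:E * \sum_(k < K) z k))%E.
  rewrite muleCA ge0_sume_distrr; last by move=> i _; exact: z0.
  rewrite !EFinM -!sumEFin -muleDr//; last by rewrite fin_num_adde_defr// sumEFin.
  by rewrite -big_split lee_wpmul2l// lee_sum.
(* The averaged penalty may be [+oo]; the left-hand side is then [-oo]. *)
by case: (c%:E * _)%E => [w| |] // xy; [rewrite leeBlDr|rewrite leNye].
Qed.


Unset Implicit Arguments.

Theorem theorem5p1 (R : realType) (dS dA : measure_display)
    (S : measurableType dS) (A : measurableType dA) (K d : nat)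
    (K_gt0 : (0 < K)%N)
    (F : federation R S A K) (tau : trajectories F)
    (* the parameterised global policy pi(.|s,theta), and the client policies *)
    (pi : 'rV[R]_d -> policy R S A) (pik : 'I_K -> 'rV[R]_d -> policy R S A)
    (* the stochastic gradients: random vectors ghat k theta on a sample space
       whose law may depend on the client and on theta *)
    (dB : measure_display) (Batch : measurableType dB)
    (PB : 'I_K -> 'rV[R]_d -> probability Batch R)
    (ghat : 'I_K -> 'rV[R]_d -> Batch -> 'rV[R]_d)
    (ghat_measurable : forall k theta i,
       measurable_fun [set: Batch] (fun b => ghat k theta b ord0 i))
    (L G sigma M mu Hmax Rmax : R) (thetastar : 'rV[R]_d)
    (mu_gt0 : 0 < mu)
    (J_differentiable : forall k theta,
       differentiable (client_objective tau pi k) theta)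
    (J_smooth : forall k theta theta',
       enorm (gradient (client_objective tau pi k) theta -
              gradient (client_objective tau pi k) theta')
       <= L * enorm (theta - theta'))
    (gradient_bounded : forall k theta,
       enorm (gradient (client_objective tau pi k) theta) <= G)
    (variance_bounded : forall k theta,
       ('E_(PB k theta)[fun b => (enorm (ghat k theta b -
            gradient (client_objective tau pi k) theta) ^+ 2)%R]
        <= (sigma ^+ 2)%:E)%E)
    (second_moment_bounded : forall k theta,
       ('E_(PB k theta)[fun b => (enorm (ghat k theta b) ^+ 2)%R]
        <= (M ^+ 2)%:E)%E)
    (thetastar_argmax : forall theta,
       global_objective tau pi theta <= global_objective tau pi thetastar)
    (polyak_lojasiewicz : forall theta,
       2 * mu * (global_objective tau pi thetastar -
                 global_objective tau pi theta)
       <= enorm (gradient (global_objective tau pi) theta) ^+ 2)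
    (feedback_bounded : forall k s a, `|feedback F k (s, a)| <= Hmax)
    (Rmax_max : is_max_reward F Rmax)
    (theta : 'rV[R]_d)
    (rho : 'I_K -> probability S R)
    (rho_state : forall k,
       state_distribution tau k (pik k theta) (rho k) \/
       state_distribution tau k (pi theta) (rho k)) :
  let Rtotalmax := Rmax + feedback_weight F * Hmax in
  let C := 2 * Num.sqrt 2 * Rtotalmax / (1 - discount F) ^+ 2 in
  ((K%:R^-1 * \sum_(k < K) intrinsic_performance tau k (pik k theta))%:E
   - C%:E * ((K%:R^-1)%:E *
       \sum_(k < K) sqrte (personalization_score (rho k) (pik k) pi theta))
   <= (global_performance tau pi theta)%:E)%E.
Proof.
cbv zeta; set C := 2 * Num.sqrt 2 * _ / _.
(* Attainment of the maximum provides a client, a state and an action, from which [Rmax] and [Hmax]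
   are seen to be nonnegative. *)
have [rewardB [k0 [s0 [a0 Rmax_eq]]]] := Rmax_max.
have Rmax_ge0 : 0 <= Rmax by rewrite -Rmax_eq.
have Hmax_ge0 : 0 <= Hmax by exact: le_trans (feedback_bounded k0 s0 a0).
have lambdaH_ge0 : 0 <= feedback_weight F * Hmax.
  by rewrite mulr_ge0// ltW// feedback_weight_gt0.
have b0 : 0 <= (1 - discount F) ^+ 2 by exact: sqr_ge0.
have C_ge0 : 0 <= C by rewrite /C divr_ge0// !mulr_ge0 ?sqrtr_ge0// addr_ge0.
apply: le_mean_gap => // [k|k]; first exact: sqrte_ge0.
have bounded_reward : bmeas Rmax (intrinsic_reward F k).
  by split=> [|[s a]]; [exact: measurable_intrinsic_reward|exact: rewardB].
have := performance_gap_le Rmax_ge0 bounded_reward (tr1 := tau k (pik k theta))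
  (tr2 := tau k (pi theta)) (rho_state k).
set J1 := trajectory_return _ _; set J2 := trajectory_return _ _; move=> J12.
rewrite -[(_ tau k (pik k theta))%:E]/(J1%:E) -[(_ tau k (pi theta))%:E]/(J2%:E).
apply: (@le_trans _ _ (J2%:E + `|J1 - J2|%:E)%E).
  by rewrite -EFinD lee_fin -lerBlDl ler_norm.
rewrite leeD2l//; apply: le_trans J12 _.
(* [Rmax] is enlarged to the total reward bound, the added term being nonnegative by
   [lambdaH_ge0]. *)
rewrite lee_wpmul2r ?sqrte_ge0// lee_fin /C ler_wpM2r ?invr_ge0//.
by rewrite ler_wpM2l ?mulr_ge0 ?sqrtr_ge0// lerDl.
Qed.
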